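(* Let $R=(r_1,\ldots,r_m)$, $C=(c_1,\ldots,c_n)$ be vectors of positive integers with $\sum_ir_i=\sum_jc_j=N$, $0<r_i<n$, $0<c_j<m$, and let $W=(w_{ij})$ be a nonnegative real $m\times n$ matrix. Let $\Sigma(R,C)$ be the set of $m\times n$ 0-1 matrices with row sums $R$ and column sums $C$, and define $$|\Sigma(R,C;W)|=\sum_{D=(d_{ij})\in\Sigma(R,C)}\ \prod_{(i,j):\,d_{ij}=1}w_{ij}.$$ For $\mathbf{x}=(x_1,\ldots,x_m)$, $\mathbf{y}=(y_1,\ldots,y_n)$ with positive coordinates let $$F(\mathbf{x},\mathbf{y};W)=\Big(\prod_{i=1}^m x_i^{-r_i}\Big)\Big(\prod_{j=1}^n y_j^{-c_j}\Big)\prod_{i,j}(1+w_{ij}x_iy_j),$$ and $\alpha(R,C;W)=\inf_{x_i>0,\,y_j>0}F(\mathbf{x},\mathbf{y};W)$. Then $$\alpha(R,C;W)\ \ge\ |\Sigma(R,C;W)|\ \ge\ \frac{(mn)!}{(mn)^{mn}}\Big(\prod_{i=1}^m\frac{(n-r_i)^{n-r_i}}{(n-r_i)!}\Big)\Big(\prod_{j=1}^n\frac{c_j^{c_j}}{c_j!}\Big)\alpha(R,C;W).$$ *)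

(* Defs.v *)
From HB Require Import structures.
From mathcomp Require Import all_boot all_order all_algebra.
From mathcomp Require Import mathcomp_extra boolp classical_sets reals.
Set Implicit Arguments.
Unset Strict Implicit.
Unset Printing Implicit Defensive.
Import Order.TTheory GRing.Theory Num.Theory.
Local Open Scope ring_scope.

(* Boolean matrices encode 0-1 matrices: true is 1 and false is 0. *)
Definition zero_one_mx (m n : nat) (r : 'I_m -> nat) (c : 'I_n -> nat) :
    {set 'M[bool]_(m, n)} :=
  finset (fun D : 'M[bool]_(m, n) =>
    [forall i, (\sum_(j < n) D i j)%N == r i] &&
    [forall j, (\sum_(i < m) D i j)%N == c j]).

Definition weighted_count (R : realType) (m n : nat)
    (r : 'I_m -> nat) (c : 'I_n -> nat) (W : 'M[R]_(m, n)) : R :=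
  \sum_(D in zero_one_mx r c) \prod_(p : 'I_m * 'I_n | D p.1 p.2) W p.1 p.2.

Definition Ffun (R : realType) (m n : nat)
    (r : 'I_m -> nat) (c : 'I_n -> nat) (W : 'M[R]_(m, n))
    (x : 'I_m -> R) (y : 'I_n -> R) : R :=
  (\prod_(i < m) x i ^- r i) * (\prod_(j < n) y j ^- c j)
  * \prod_(i < m) \prod_(j < n) (1 + W i j * x i * y j).

(* The set is nonempty and, when W is entrywise nonnegative, bounded below by
   0; [inf] is then the genuine infimum and not its default value. *)
Definition alpha (R : realType) (m n : nat)
    (r : 'I_m -> nat) (c : 'I_n -> nat) (W : 'M[R]_(m, n)) : R :=
  inf [set z : R | exists (x : 'I_m -> R) (y : 'I_n -> R),
         [/\ forall i, 0 < x i, forall j, 0 < y j & z = Ffun r c W x y]]%classic.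

(* Main.v *)
Require Import Defs.
From HB Require Import structures.
From mathcomp Require Import all_boot all_order all_algebra.
From mathcomp Require Import mathcomp_extra boolp classical_sets reals.
From mathcomp Require Import mpoly complex ring zify.
Set Implicit Arguments.
Unset Strict Implicit.
Unset Printing Implicit Defensive.
Import Order.TTheory GRing.Theory Num.Theory.
Local Open Scope ring_scope.

(* Substituting s_i = 1 / x_i, the weighted count is the coefficient of
   s^(n-r) y^c in p = prod_(i, j) (s_i + w_ij y_j), and alpha is the largest
   constant with p >= alpha s^(n-r) y^c on the positive orthant. The upper bound
   is then the nonnegativity of the coefficients of p. The lower bound is
   Gurvits's capacity argument, one variable t with exponent k at a time: if p is
   homogeneous of degree D and stable, then t |-> p(z, t) has only negative real
   roots when z > 0, and AM-GM applied k times bounds its coefficient of t^k from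
   below by
     (k^k / k!) ((D-k)^(D-k) / (D-k)!) (D! / D^D) inf_t p(z, t) / t^k.
   By the Gauss-Lucas theorem this coefficient is a stable polynomial in z,
   homogeneous of degree D - k, and the constants telescope. *)

(** * Gauss-Lucas in a half-plane *)

Lemma size_deriv_num (F : numDomainType) (f : {poly F}) d :
  size f = d.+2 -> size f^`() = d.+1.
Proof.
move=> sf; apply/eqP; rewrite eqn_leq; apply/andP; split.
  by rewrite -ltnS -sf lt_size_deriv // -size_poly_eq0 sf.
rewrite ltnNge; apply/negP => le_d.
have : f^`()`_d = 0 by apply/leq_sizeP: le_d.
rewrite coef_deriv => /eqP; rewrite mulrn_eq0 /= => /eqP f0.
have : lead_coef f != 0 by rewrite lead_coef_eq0 -size_poly_eq0 sf.
by rewrite lead_coefE sf /= f0 eqxx.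
Qed.

(** The logarithmic derivative; [z \notin s] keeps every inverse genuine. *)
Lemma deriv_prod_XsubC (F : fieldType) (s : seq F) (z : F) :
  z \notin s ->
  (\prod_(a <- s) ('X - a%:P))^`().[z]
    = (\prod_(a <- s) ('X - a%:P)).[z] * \sum_(a <- s) (z - a)^-1.
Proof.
elim: s => [|a s IH]; first by rewrite !big_nil derivE !hornerE.
rewrite inE negb_or => /andP[za zs]; rewrite !big_cons derivM !derivE.
by rewrite subr0 mul1r hornerD !hornerM IH // hornerXsubC; field; rewrite subr_eq0.
Qed.

Section ComplexPolynomials.
Variable R : realType.
Local Notation C := R[i].
Local Notation Re := (@complex.Re R).
Implicit Types (z u : C) (f : {poly C}).

Lemma ReD (z u : C) : Re (z + u) = Re z + Re u.
Proof. by case: z u => ? ? []. Qed.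

Lemma Re_sum (I : Type) (s : seq I) (P : pred I) (F : I -> C) :
  Re (\sum_(i <- s | P i) F i) = \sum_(i <- s | P i) Re (F i).
Proof. exact: (big_morph Re ReD). Qed.

Lemma Re_inv_gt0 z : 0 < Re z -> 0 < Re z^-1.
Proof.
case: z => a b /= a0; apply: divr_gt0 => //.
by rewrite ltr_wpDr ?sqr_ge0 // exprn_gt0.
Qed.

(* Logarithmic differentiation: every term u^-1 / (z - a) of
   u^-1 * f'(z) / f(z) has positive real part as soon as Re (u z) >= 0. *)
Lemma Gauss_Lucas f u : (1 < size f)%N ->
  (forall z, root f z -> Re (u * z) < 0) ->
  forall z, root f^`() z -> Re (u * z) < 0.
Proof.
move=> sf fu z; have [s fE] := closed_field_poly_normal f.
have lf : lead_coef f != 0.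
  by rewrite lead_coef_eq0 -size_poly_eq0; case: (size f) sf.
have sneg a : a \in s -> Re (u * a) < 0.
  by move=> sa; apply: fu; rewrite fE rootZ // root_prod_XsubC.
have s0 : s != [::].
  apply: contraTneq sf => s0.
  by rewrite fE s0 big_nil size_scale // size_poly1.
rewrite !ltNge => fz; apply/negP => uz.
have zs : z \notin s by apply/negP => /sneg; rewrite ltNge uz.
move: fz; rewrite fE derivZ rootZ // rootE deriv_prod_XsubC // mulf_eq0.
apply/negP; rewrite negb_or -rootE root_prod_XsubC zs /=.
have u0 : u != 0.
  case: s s0 sneg {fE zs} => // a s _ /(_ a (mem_head _ _)).
  by apply: contraTneq => ->; rewrite mul0r ltxx.
apply: contraTneq isT => /(congr1 (fun x => u^-1 * x)).
rewrite mulr0 mulr_sumr => /(congr1 Re); rewrite Re_sum /=.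
have pos a : a \in s -> 0 < Re (u^-1 * (z - a)^-1).
  move=> sa; rewrite -invfM Re_inv_gt0 // mulrBr ReD.
  have -> : Re (- (u * a)) = - Re (u * a) by case: (u * a).
  by rewrite subr_gt0 (lt_le_trans (sneg _ sa)).
case: s s0 pos {fE sneg zs} => // a s _ pos; rewrite big_cons => /eqP.
rewrite gt_eqF // ltr_wpDr ?pos ?mem_head // big_seq sumr_ge0 // => b sb.
by rewrite ltW // pos // inE sb orbT.
Qed.

(** Up to a factorial, coefficient [k] is the constant term of the [k]-th derivative. By Gauss-Lucas
    the roots of that derivative stay in the open left half-plane, so 0 is not among them. *)
Lemma coef_neq0_of_Re_root_lt0 f k : (k < size f)%N ->
  (forall z, root f z -> Re z < 0) -> f`_k != 0.
Proof.
elim: k f => [|k IH] f kf fneg.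
  apply/negP; rewrite -horner_coef0 => /fneg.
  by rewrite /= ltxx.
have := size_deriv_num; case sf: (size f) kf => [//|[//|d]] kd /(_ _ f d sf) sf'.
have := IH f^`(); rewrite sf' coef_deriv mulrn_eq0 /=; apply => //.
move=> z fz; rewrite -[z]mul1r; apply: (@Gauss_Lucas f); rewrite ?sf //.
by move=> a fa; rewrite mul1r fneg.
Qed.

End ComplexPolynomials.

(** * Univariate polynomials with negative roots *)

Lemma AGM_seq (F : numFieldType) (s : seq F) : all (>= 0) s ->
  \prod_(a <- s) a <= ((\sum_(a <- s) a) / (size s)%:R) ^+ size s.
Proof.
move=> s0; rewrite (big_nth 0) [\sum_(_ <- s) _](big_nth 0) !big_mkord.
have [|+ _] := @leif_AGM F 'I_(size s) predT (fun i => s`_i).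
  by move=> i _; apply: (allP s0); rewrite mem_nth.
by rewrite card_ord.
Qed.

(** AM-GM for [k] copies of [u / k] and one copy of [s]. For [k = 0] the convention [0 ^+ 0 = 1]
    leaves [s <= u + s]. *)
Lemma AGM_pow (F : numFieldType) (k : nat) (u s : F) : 0 <= u -> 0 <= s ->
  k.+1%:R ^+ k.+1 * (u ^+ k * s) <= k%:R ^+ k * (u + s) ^+ k.+1.
Proof.
move=> u0 s0; case: k => [|k].
  by rewrite !expr1 !expr0 !mul1r lerDr.
have := @AGM_seq F (s :: nseq k.+1 (u / k.+1%:R)).
rewrite [all _ _]/= !big_cons !big_nseq [size _]/= size_nseq iter_mulr_1 iter_addr_0.
rewrite s0 divr_ge0 //= all_nseq divr_ge0 ?orbT // => /(_ isT).
have k1 : 0 < k.+1%:R :> F by rewrite ltr0n.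
have k2 : 0 < k.+2%:R :> F by rewrite ltr0n.
rewrite -exprS -mulrS -[(u / _) *+ _]mulr_natr divfK ?gt_eqF // !exprMn !exprVn.
rewrite ler_pdivlMr ?exprn_gt0 // mulrAC mulrA ler_pdivrMr ?exprn_gt0 // => H.
by rewrite mulrA mulrC [leRHS]mulrC [u + s]addrC mulrA.
Qed.

Section NegativeRoots.
Variable R : realType.
Local Notation C := R[i].
Local Notation Re := (@complex.Re R).
Implicit Types (f : {poly R}) (u s t M : R).

(* All complex roots of f lie on the negative real axis, which is the set of
   the z with Re (w z) < 0 for every w in the right half-plane. *)
Definition neg_roots f := forall z w : C,
  root (map_poly (real_complex R) f) z -> 0 < Re w -> Re (w * z) < 0.

Lemma neg_roots_deriv f : (1 < size f)%N -> neg_roots f -> neg_roots f^`().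
Proof.
move=> sf fneg z w; rewrite -deriv_map => fz w0.
apply: Gauss_Lucas fz; first by rewrite size_map_poly.
by move=> a fa; apply: fneg.
Qed.

Lemma neg_roots_factor f : f != 0 -> neg_roots f ->
  exists2 s : seq R, f = lead_coef f *: \prod_(a <- s) ('X - a%:P) &
                     all (< 0) s.
Proof.
move=> f0 fneg.
have [s fE] := closed_field_poly_normal (map_poly (real_complex R) f).
have lf : lead_coef (map_poly (real_complex R) f) != 0.
  by rewrite lead_coef_eq0 map_poly_eq0.
have sneg a : a \in s -> a = (Re a)%:C%C /\ Re a < 0.
  move=> sa; have ra w : 0 < Re w -> Re (w * a) < 0.
    by apply: fneg; rewrite fE rootZ // root_prod_XsubC.
  case: a sa ra => a b sa ra; have a0 : a < 0.
    by have := ra 1 ltr01; rewrite mul1r.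
  split=> //; congr (_ +i* _)%C; apply/eqP; apply: contraT => b0.
  (* This multiplier has real part 1 and rotates [a + i b] onto the imaginary axis, which [ra]
     forbids. *)
  have := ra (1 +i* (a / b))%C ltr01.
  by rewrite /= mul1r divfK // subrr ltxx.
exists (map Re s); last by apply/allP => _ /mapP[a /sneg[_ a0] ->].
apply: (@map_poly_inj _ _ (real_complex R)).
rewrite fE map_polyZ /= lead_coef_map rmorph_prod big_map; congr (_ *: _).
rewrite big_seq [RHS]big_seq; apply: eq_bigr => a /sneg[aE _].
by rewrite rmorphB /= map_polyX map_polyC /= -aE.
Qed.

(** Every factor [u - a] is positive on the half-line, so [f] has there the sign of its leading
    coefficient, which the value at 1 reveals. *)
Lemma neg_roots_horner_gt0 f u : neg_roots f -> 0 < f.[1] -> 0 <= u ->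
  0 < f.[u].
Proof.
move=> fneg f1 u0; have f0 : f != 0.
  by apply: contraTneq f1 => ->; rewrite horner0 ltxx.
have [s fE sneg] := neg_roots_factor f0 fneg.
have prod_gt0 v : 0 <= v -> 0 < (\prod_(a <- s) ('X - a%:P)).[v].
  move=> v0; rewrite horner_prod big_seq prodr_gt0 // => a sa.
  by rewrite hornerXsubC subr_gt0 (lt_le_trans (allP sneg _ sa)).
have lf : 0 < lead_coef f.
  by move: f1; rewrite {1}fE hornerZ pmulr_lgt0 // prod_gt0.
by rewrite {1}fE hornerZ mulr_gt0 // prod_gt0.
Qed.

(* AM-GM applied to the factors 1 + s / (u - a) of f(u + s) / f(u), whose
   average is 1 + s f'(u) / (D f(u)) where D is the degree of f. *)
Lemma neg_roots_growth f d u s : neg_roots f -> 0 < f.[1] ->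
  size f = d.+2 -> 0 <= u -> 0 <= s ->
  0 < f^`().[u] /\
  f.[u + s] <= f.[u] * (1 + s * f^`().[u] / f.[u] / d.+1%:R) ^+ d.+1.
Proof.
move=> fneg f1 sf u0 s0; have fu := neg_roots_horner_gt0 fneg f1 u0.
have f0 : f != 0 by rewrite -size_poly_eq0 sf.
have [r fE rneg] := neg_roots_factor f0 fneg.
have szr : size r = d.+1.
  apply/eqP; rewrite -eqSS -sf {1}fE size_scale ?lead_coef_eq0 //.
  by rewrite size_prod_XsubC.
have ua a : a \in r -> 0 < u - a.
  by move=> ra; rewrite subr_gt0 (lt_le_trans (allP rneg _ ra)).
have ur : u \notin r by apply/negP => /ua; rewrite subrr ltxx.
have f'E : f^`().[u] = f.[u] * \sum_(a <- r) (u - a)^-1.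
  by rewrite {1 2}fE derivZ !hornerZ deriv_prod_XsubC // mulrA.
have fusE : f.[u + s] = f.[u] * \prod_(a <- r) (1 + s / (u - a)).
  rewrite {1 2}fE !hornerZ !horner_prod -mulrA -big_split /=; congr (_ * _).
  rewrite big_seq [RHS]big_seq; apply: eq_bigr => a /ua ra.
  by rewrite !hornerXsubC mulrDr mulr1 mulrC divfK ?gt_eqF // addrAC.
split.
  rewrite f'E mulr_gt0 //; case: r szr ua {fE rneg ur f'E fusE} => // a r _ ua.
  rewrite big_cons ltr_wpDr ?invr_gt0 ?ua ?mem_head // big_seq sumr_ge0 //.
  by move=> b rb; rewrite invr_ge0 ltW // ua // inE rb orbT.
rewrite fusE ler_pM2l // -mulrA f'E.
have := @AGM_seq R (map (fun a => 1 + s / (u - a)) r).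
rewrite !big_map size_map szr; have -> : all (>= 0) [seq 1 + s / (u - a) | a <- r].
  by apply/allP => _ /mapP[a /ua ra ->]; rewrite addr_ge0 // divr_ge0 // ltW.
move=> /(_ isT) /le_trans; apply; rewrite le_eqVlt; apply/orP; left; apply/eqP.
congr (_ ^+ _); rewrite big_split /= big_const_seq count_predT szr iter_addr_0.
rewrite -mulr_sumr mulrDl divff ?pnatr_eq0 //; congr (_ + _).
by field; rewrite nat1r pnatr_eq0 (gt_eqF fu).
Qed.

(** With [D = d + 2] the degree, [s = D f(u) / ((D - 1) f'(u))] minimises the bound of
    [neg_roots_growth] on [f(u + s) / s]. The average factor becomes [D / (D - 1)], and one of its
    [D] copies turns [f(u)] into [s f'(u)]. *)
Lemma neg_roots_deriv_lb f d u : neg_roots f -> 0 < f.[1] ->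
  size f = d.+3 -> 0 <= u ->
  exists2 s : R, 0 < s & d.+1%:R ^+ d.+1 * f.[u + s]
                       <= d.+2%:R ^+ d.+1 * (s * f^`().[u]).
Proof.
move=> fneg f1 sf u0; have fu := neg_roots_horner_gt0 fneg f1 u0.
have [f'u _] := neg_roots_growth fneg f1 sf u0 (lexx 0).
have d1 : 0 < d.+1%:R :> R by rewrite ltr0n.
have d2 : 0 < d.+2%:R :> R by rewrite ltr0n.
pose s := d.+2%:R * f.[u] / (f^`().[u] * d.+1%:R).
have s0 : 0 < s by rewrite divr_gt0 ?mulr_gt0.
exists s => //; have [_] := neg_roots_growth fneg f1 sf u0 (ltW s0).
have e : d.+2%:R = d.+1%:R + 1 :> R by rewrite natr1.
have -> : 1 + s * f^`().[u] / f.[u] / d.+2%:R = d.+2%:R / d.+1%:R.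
  rewrite /s; move: (d.+1%:R) (d.+2%:R) d1 d2 e => a b a0 b0 e; rewrite e in b0 *.
  by field; rewrite !gt_eqF.
rewrite [(_ / _) ^+ _]exprS (mulrA f.[u]).
have -> : f.[u] * (d.+2%:R / d.+1%:R) = s * f^`().[u].
  rewrite /s; move: (d.+1%:R) (d.+2%:R) d1 d2 => a b a0 b0.
  by field; rewrite !gt_eqF.
rewrite expr_div_n (mulrA (s * _)) ler_pdivlMr ?exprn_gt0 // => H.
by rewrite mulrC [leRHS]mulrC.
Qed.

(** Induction on [k] through the derivative, whose coefficient of index [k - 1] is [k] times
    coefficient [k] of [f]: a lower bound on [f] by a multiple of [t ^+ k] yields one on its
    derivative by a multiple of [t ^+ (k - 1)]. *)
Lemma neg_roots_coef_lb f D k M : size f = D.+1 -> neg_roots f -> 0 < M ->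
  (0 < k <= D)%N -> (forall t, 0 < t -> M * t ^+ k <= f.[t]) ->
  M * (k%:R ^+ k * (D - k)%:R ^+ (D - k)%N * D`!%:R)
    <= f`_k * (k`!%:R * (D - k)`!%:R * D%:R ^+ D).
Proof.
elim: k f D M => [//|k IH] f [//|d] M sf fneg M0 /= kd fM.
have f1 : 0 < f.[1] by apply: lt_le_trans (fM 1 ltr01); rewrite expr1n mulr1.
have d1 : 0 < d.+1%:R :> R by rewrite ltr0n.
case: k IH kd fM => [|k] IH kd fM.
  rewrite subn1 /= !expr1 (factS 0) fact0 muln1 !mul1r (factS d) [d.+1%:R ^+ _]exprS natrM.
  case: d sf kd d1 => [|d] sf _ d1.
    rewrite !expr0 fact0 !mulr1 leNgt; apply/negP => fltM.
    (* Degree 1: if the slope were below [M], the line would fall under [M * t]. At this [t] the gap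
       [(M - f_1) t] is [|f_0| + 1], which exceeds [f_0]. *)
    pose t := (`|f`_0| + 1) / (M - f`_1).
    have t0 : 0 < t by rewrite divr_gt0 ?subr_gt0 // ltr_wpDl.
    have := fM t t0; rewrite horner_coef sf !big_ord_recl big_ord0 /= !expr1 expr0.
    rewrite mulr1 addr0 -lerBlDr -mulrBl /t mulrC divfK ?gt_eqF ?subr_gt0 //.
    by apply/negP; rewrite -ltNge (le_lt_trans (ler_norm _)) // ltrDl.
  (* Exponent 1: the derivative at 0 is the coefficient itself, and [M * s <= f.[s]] lets [s]
     cancel. *)
  have [s s0] := neg_roots_deriv_lb fneg f1 sf (lexx 0).
  rewrite add0r horner_coef0 coef_deriv mulr1n => le_s.
  have fd : 0 < d.+1`!%:R :> R by rewrite ltr0n fact_gt0.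
  have : d.+1%:R ^+ d.+1 * M <= d.+2%:R ^+ d.+1 * f`_1.
    rewrite -(ler_pM2r s0) -!mulrA (le_trans _ (le_trans le_s _)) //.
      by rewrite ler_pM2l ?exprn_gt0 ?ltr0n //; have := fM s s0; rewrite expr1.
    by rewrite [s * _]mulrC.
  rewrite -(ler_pM2r (mulr_gt0 d1 fd)) => H.
  apply: le_trans (le_trans H _); rewrite le_eqVlt; apply/orP; left; apply/eqP; ring.
case: d sf kd d1 => [//|d] sf kd d1.
have e1 : 0 < d.+1%:R :> R by rewrite ltr0n.
have k1 : 0 < k.+1%:R :> R by rewrite ltr0n.
(* The powers of [d + 1] and [d + 2] come from [neg_roots_deriv_lb] at [t]; those of [k + 1] and
   [k + 2] come from [AGM_pow], which bounds [(t + s) ^+ k.+2 / s] below by a multiple of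
   [t ^+ k.+1]. *)
pose M' := M * d.+1%:R ^+ d.+1 * k.+2%:R ^+ k.+2 / (d.+2%:R ^+ d.+1 * k.+1%:R ^+ k.+1).
have M'0 : 0 < M'.
  by rewrite divr_gt0 // mulr_gt0 ?exprn_gt0 ?ltr0n // mulr_gt0 // exprn_gt0.
have sf' : size f^`() = d.+2 by rewrite (@size_deriv_num _ f d.+1).
have f'M t : 0 < t -> M' * t ^+ k.+1 <= f^`().[t].
  move=> t0; have [s s0 le_s] := neg_roots_deriv_lb fneg f1 sf (ltW t0).
  rewrite /M' mulrAC ler_pdivrMr ?mulr_gt0 ?exprn_gt0 ?ltr0n //.
  rewrite -(ler_pM2r s0).
  have := AGM_pow k.+1 (ltW t0) (ltW s0); have := fM _ (addr_gt0 t0 s0).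
  have := exprn_gt0 d.+1 e1; have := exprn_gt0 k.+1 k1; move: le_s.
  move: (k.+1%:R ^+ k.+1) (d.+1%:R ^+ d.+1) (d.+2%:R ^+ d.+1) => x a b.
  move: (k.+2%:R ^+ k.+2) ((t + s) ^+ k.+2) (t ^+ k.+1) => z y T le_s x0 a0 H1 H0.
  have -> : M * a * z * T * s = M * a * (z * (T * s)) by ring.
  have -> : f^`().[t] * (b * x) * s = x * (b * (s * f^`().[t])) by ring.
  apply: (@le_trans _ _ (M * a * (x * y))); first by rewrite ler_pM2l ?mulr_gt0.
  have -> : M * a * (x * y) = x * (a * (M * y)) by ring.
  by rewrite ler_pM2l // (le_trans _ le_s) // ler_pM2l.
have sf2 : (1 < size f)%N by rewrite sf.
have := IH _ _ _ sf' (neg_roots_deriv sf2 fneg) M'0 _ f'M.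
rewrite ltnS in kd; rewrite kd => /(_ isT); rewrite !subSS coef_deriv.
(* Multiplying by [D^D / (D - 1)^(D - 1)], where [D = d + 2], converts the constants of degree
   [D - 1] into those of degree [D]. *)
have D0 : 0 < d.+2%:R * d.+2%:R ^+ d.+1 / d.+1%:R ^+ d.+1 :> R.
  by rewrite divr_gt0 ?mulr_gt0 ?exprn_gt0.
rewrite -(ler_pM2r D0) => H.
have a0 : d.+1%:R ^+ d.+1 != 0 :> R by rewrite gt_eqF ?exprn_gt0.
have b0 : d.+2%:R ^+ d.+1 != 0 :> R by rewrite gt_eqF ?exprn_gt0.
have c0 : k.+1%:R ^+ k.+1 != 0 :> R by rewrite gt_eqF ?exprn_gt0.
apply: le_trans (le_trans H _); rewrite le_eqVlt; apply/orP; left; apply/eqP.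
  rewrite /M' factS natrM.
  move: (d.+1%:R ^+ d.+1) (d.+2%:R ^+ d.+1) (k.+1%:R ^+ k.+1) a0 b0 c0 => a b c a0 b0 c0.
  move: (d.+2%:R) (k.+2%:R ^+ k.+2) ((d - k)%:R ^+ _) (d.+1`!%:R) => D K X Y.
  by field; rewrite a0 b0 c0.
rewrite -[f`_ _ *+ _]mulr_natr (factS k.+1) natrM [d.+2%:R ^+ d.+2]exprS.
move: (d.+1%:R ^+ d.+1) (d.+2%:R ^+ d.+1) a0 b0 => a b a0 b0.
move: (d.+2%:R) (k.+2%:R) (k.+1`!%:R) ((d - k)`!%:R) (f`_ _) => D K X Y Z.
by field; rewrite a0.
Qed.

End NegativeRoots.

(** * Stable homogeneous polynomials *)

Section LastVariable.
Variables (n : nat) (R : comNzRingType).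
Implicit Types (p : {mpoly R[n.+1]}) (m : 'X_{1..n}).

Definition fun_rcons (T : Type) (h : 'I_n -> T) (t : T) : 'I_n.+1 -> T :=
  fun i => oapp h t (unlift ord_max i).

Lemma fun_rcons_max (T : Type) (h : 'I_n -> T) t : fun_rcons h t ord_max = t.
Proof. by rewrite /fun_rcons unlift_none. Qed.

Lemma fun_rcons_widen (T : Type) (h : 'I_n -> T) t i :
  fun_rcons h t (widen_ord (leqnSn n) i) = h i.
Proof.
have -> : widen_ord (leqnSn n) i = lift ord_max i.
  by apply: val_inj; rewrite /= /bump leqNgt ltn_ord.
by rewrite /fun_rcons liftK.
Qed.

Definition mnm_rcons m (k : nat) : 'X_{1..n.+1} :=
  [multinom fun_rcons m k i | i < n.+1].

Definition mnm_belast (m : 'X_{1..n.+1}) : 'X_{1..n} :=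
  [multinom m (widen_ord (leqnSn n) i) | i < n].

Lemma mnm_rcons_max m k : mnm_rcons m k ord_max = k.
Proof. by rewrite mnmE fun_rcons_max. Qed.

Lemma mnm_rconsK m k : mnm_belast (mnm_rcons m k) = m.
Proof. by apply/mnmP => i; rewrite !mnmE fun_rcons_widen. Qed.

Lemma mdeg_belast (m : 'X_{1..n.+1}) :
  mdeg m = (mdeg (mnm_belast m) + m ord_max)%N.
Proof.
rewrite !mdegE big_ord_recr /=; congr (_ + _)%N.
by apply: eq_bigr => i _; rewrite mnmE.
Qed.

Lemma mmap1_belast (S : comNzRingType) (h : 'I_n.+1 -> S) (m : 'X_{1..n.+1}) :
  mmap1 h m = mmap1 (h \o widen_ord (leqnSn n)) (mnm_belast m) * h ord_max ^+ m ord_max.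
Proof.
rewrite /mmap1 big_ord_recr /=; congr (_ * _).
by apply: eq_bigr => i _; rewrite mnmE.
Qed.

(** The bridge between zeros of [p] and roots of the univariate polynomial in its last variable. *)
Lemma horner_muni (S : comNzRingType) (f : {rmorphism R -> S}) (h : 'I_n -> S) t p :
  (map_poly (mmap f h) (muni p)).[t] = mmap f (fun_rcons h t) p.
Proof.
rewrite muniE rmorph_sum horner_sum; apply: eq_bigr => m _ /=.
rewrite map_polyZ map_polyXn hornerZ hornerXn /= mmapZ mmapX -mulrA.
rewrite mmap1_belast fun_rcons_max; congr (_ * (_ * _)).
by apply: mmap1_eq => i; rewrite /= fun_rcons_widen.
Qed.

Lemma mcoeff_muni p (m : 'X_{1..n.+1}) :
  p@_m = ((muni p)`_(m ord_max))@_(mnm_belast m).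
Proof.
rewrite muniE coef_sum raddf_sum {1}[p]mpolyE raddf_sum; apply: eq_bigr => a _ /=.
rewrite coefZ coefXn -/(mnm_belast a).
case: (eqVneq (m ord_max)) => [ma|ma]; last first.
  rewrite mulr0 mcoeff0 mcoeffZ mcoeffX.
  by case: (a =P m) ma => [->|_ _]; rewrite ?eqxx // mulr0.
rewrite mulr1 !mcoeffZ !mcoeffX; congr (_ * (nat_of_bool _)%:R).
apply/eqP/eqP => [->//|/mnmP am]; apply/mnmP => i.
have [j ->|->] := unliftP ord_max i; last by rewrite ma.
have -> : lift ord_max j = widen_ord (leqnSn n) j.
  by apply: val_inj; rewrite /= /bump leqNgt ltn_ord.
by have := am j; rewrite !mnmE.
Qed.

Lemma mcoeff_muni_rcons p m k : ((muni p)`_k)@_m = p@_(mnm_rcons m k).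
Proof. by rewrite (mcoeff_muni p) mnm_rcons_max mnm_rconsK. Qed.

(** For [k > D] the coefficient has empty support, so the truncated subtraction does no harm. *)
Lemma muni_homog p D k : p \is D.-homog -> (muni p)`_k \is (D - k).-homog.
Proof.
move=> /dhomogP pD; apply/dhomogP => m; rewrite mcoeff_msupp mcoeff_muni_rcons.
rewrite -mcoeff_msupp => /pD; rewrite /= mdeg_belast mnm_rcons_max mnm_rconsK => <-.
by rewrite addnK.
Qed.

Lemma size_muni_homog p D : p \is D.-homog -> (size (muni p) <= D.+1)%N.
Proof.
move=> /dhomogP pD; apply/leq_sizeP => k Dk; apply/mpolyP => m.
rewrite mcoeff0 mcoeff_muni_rcons; apply: contraTeq Dk.
rewrite -mcoeff_msupp => /pD; rewrite /= mdeg_belast mnm_rcons_max => <-.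
by rewrite -leqNgt leq_addl.
Qed.

End LastVariable.

Lemma mmap_homogZ (n : nat) (R S : comNzRingType) (f : {rmorphism R -> S})
    (p : {mpoly R[n]}) (D : nat) (h : 'I_n -> S) (c : S) :
  p \is D.-homog -> mmap f (fun i => c * h i) p = c ^+ D * mmap f h p.
Proof.
move=> /dhomogP pD; rewrite /mmap mulr_sumr big_seq [RHS]big_seq.
apply: eq_bigr => m /pD /= <-; rewrite mulrCA; congr (_ * _).
rewrite /mmap1 mdegE -prodrXr -big_split /=.
by apply: eq_bigr => i _; rewrite exprMn.
Qed.

Section Stability.
Variable R : realType.
Local Notation C := R[i].
Local Notation Re := (@complex.Re R).
Local Notation Im := (@complex.Im R).
Local Notation ev z p := (mmap (real_complex R) z p).

Definition in_cone (n : nat) (z : 'I_n -> C) :=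
  (exists i, z i != 0) /\ (forall i, z i = 0 \/ 0 < Re (z i)).

(* The cone contains 0 in each coordinate, so that a coordinate can be set to 0
   without a limiting argument. *)
Definition stable (n : nat) (p : {mpoly R[n]}) :=
  forall z : 'I_n -> C, in_cone z -> ev z p != 0.

(** The rotation changes [Re z_i] into [Re z_i - w Im z_i], which stays positive for small [w]; zero
    coordinates stay zero. *)
Lemma in_cone_rotate (n : nat) (z : 'I_n -> C) : in_cone z ->
  exists2 d : R, 0 < d &
    forall w : R, `|w| <= d -> in_cone (fun i => (1 +i* w)%C * z i).
Proof.
(* [F i] is 0 at a zero coordinate, the inverse of 0 being 0. The bound [d] is the inverse of a
   number exceeding every [F i]; its summand 1 keeps it positive. *)
move=> [[i0 zi0] zH]; pose F i := `|Im (z i)| / Re (z i).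
have F0 i : 0 <= F i.
  rewrite /F; case: (zH i) => [->|zi]; first by rewrite /= invr0 mulr0.
  by rewrite divr_ge0 // ltW.
have S0 : 0 < 1 + \sum_i F i by rewrite ltr_wpDr // sumr_ge0.
exists (1 + \sum_i F i)^-1; first by rewrite invr_gt0.
move=> w wd; split.
  exists i0; rewrite mulf_neq0 //.
  by rewrite eq_complex /= oner_eq0.
move=> i; case: (zH i) => [->|zi]; [by left; rewrite mulr0 | right].
have -> : Re ((1 +i* w)%C * z i) = Re (z i) - w * Im (z i).
  by case: (z i) => a b /=; rewrite mul1r.
rewrite subr_gt0 (le_lt_trans (ler_norm _)) // normrM.
apply: le_lt_trans (ler_wpM2r (normr_ge0 _) wd) _.
rewrite mulrC ltr_pdivrMr // mulrC -ltr_pdivrMr //.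
have Fi : 0 <= \sum_(j | j != i) F j by apply: sumr_ge0 => j _; apply: F0.
by rewrite -/(F i) (bigD1 i) //= addrCA ltrDl ltr_wpDr.
Qed.

Lemma in_cone_rcons (n : nat) (z : 'I_n -> C) (t : C) :
  in_cone z -> t = 0 \/ 0 < Re t -> in_cone (fun_rcons z t).
Proof.
move=> [[i zi] zH] tH; split.
  by exists (widen_ord (leqnSn n) i); rewrite fun_rcons_widen.
by move=> j; rewrite /fun_rcons; case: unliftP => [k _|_] /=.
Qed.

Lemma fun_rconsZ (n : nat) (z : 'I_n -> C) (t w : C) :
  fun_rcons (fun i => w * z i) (w * t) =1 (fun i => w * fun_rcons z t i).
Proof. by move=> i; rewrite /fun_rcons; case: unliftP. Qed.

Lemma mmap_eq (n : nat) (h1 h2 : 'I_n -> C) (p : {mpoly R[n]}) :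
  h1 =1 h2 -> ev h1 p = ev h2 p.
Proof. by move=> h; apply: eq_bigr => m _; rewrite (mmap1_eq _ h). Qed.

Section LastVariableRoots.
Variables (n D : nat) (p : {mpoly R[n.+1]}).
Hypotheses (pD : p \is D.-homog) (p_stable : stable p).

(* A root t with Re t >= 0 outside the cone is purely imaginary; by homogeneity
   rotating (z, t) slightly brings it into the cone. *)
Lemma stable_root_lt0 (z : 'I_n -> C) (t : C) : in_cone z ->
  root (map_poly (mmap (real_complex R) z) (muni p)) t -> Re t < 0.
Proof.
move=> zH; rewrite rootE horner_muni => /eqP pt; rewrite ltNge; apply/negP => t0.
have [tE|tN] := boolP ((t == 0) || (0 < Re t)).
  have tH : t = 0 \/ 0 < Re t by case/orP: tE => [/eqP|]; [left | right].
  by have := p_stable (in_cone_rcons zH tH); rewrite pt eqxx.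
have [d d0 dH] := in_cone_rotate zH.
have {tN} [rt it] : Re t = 0 /\ Im t != 0.
  move: tN t0; rewrite negb_or -leNgt; case: t {pt} => a b /= /andP[ab a0 a0'].
  have aE : a = 0 by apply: le_anti; rewrite a0 a0'.
  by split=> //; apply: contraNneq ab => ->; rewrite aE eq_complex /= eqxx.
(* As [Re t = 0], the rotated root has real part [- w Im t], which this sign makes equal to
   [d |Im t|]. *)
pose w := - (d * Num.sg (Im t)).
have wd : `|w| <= d.
  by rewrite normrN normrM normr_sg it mulr1 gtr0_norm.
have wt : 0 < Re ((1 +i* w)%C * t).
  have -> : Re ((1 +i* w)%C * t) = Re t - w * Im t.
    by case: (t) => a b /=; rewrite mul1r.
  rewrite rt sub0r /w mulNr opprK -mulrA mulr_gt0 //.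
  by rewrite -normrEsg normr_gt0.
have := p_stable (in_cone_rcons (dH w wd) (or_intror wt)).
rewrite (mmap_eq _ (@fun_rconsZ _ z t (1 +i* w)%C)).
by rewrite (mmap_homogZ _ _ _ pD) pt mulr0 eqxx.
Qed.

(** The coefficient of index [D] is a constant, equal to [p(0, ..., 0, 1)], and the cone contains
    that point. *)
Lemma size_muni_stable (z : 'I_n -> C) :
  size (map_poly (mmap (real_complex R) z) (muni p)) = D.+1.
Proof.
apply/eqP; rewrite eqn_leq (leq_trans (size_poly _ _)) ?size_muni_homog //=.
rewrite ltnNge; apply/negP => le_D.
(* Writing the origin as [0 * z i] lets homogeneity evaluate each coefficient there: the factor
   [0 ^+ (D - k)] is 0 for [k < D] and 1 for [k = D]. *)
pose o i : C := 0 * z i.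
have oE k : ev o (muni p)`_k = 0 ^+ (D - k) * ev z (muni p)`_k.
  by rewrite (mmap_homogZ _ _ _ (muni_homog k pD)).
have oH : in_cone (fun_rcons o 1).
  split; first by exists ord_max; rewrite fun_rcons_max oner_neq0.
  move=> i; rewrite /fun_rcons; case: unliftP => [j _|_] /=.
    by left; rewrite /o mul0r.
  by right; rewrite ltr01.
have /eqP := p_stable oH; apply.
rewrite -horner_muni (@horner_coef_wide _ D.+1); last first.
  by rewrite (leq_trans (size_poly _ _)) // size_muni_homog.
rewrite big1 // => k _; rewrite expr1n mulr1 coef_map /= oE.
have [kD|] := eqVneq (k : nat) D; last first.
  move=> kD; have := ltn_ord k; rewrite ltnS leq_eqVlt (negPf kD) /= => {}kD.
  by rewrite expr0n subn_eq0 leqNgt kD mul0r.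
by rewrite kD -coef_map (leq_sizeP _ _ le_D) // mulr0.
Qed.

(** Over each cone point the degree is exactly [D] and all roots lie in the open left half-plane, so
    Gauss-Lucas excludes a vanishing coefficient. *)
Lemma stable_muni_coef k : (k <= D)%N -> stable (muni p)`_k.
Proof.
move=> kD z zH; rewrite -coef_map.
apply: coef_neq0_of_Re_root_lt0; first by rewrite size_muni_stable.
by move=> t; apply: stable_root_lt0.
Qed.

End LastVariableRoots.

Lemma map_meval_complex (n : nat) (p : {mpoly R[n.+1]}) (x : 'I_n -> R) :
  map_poly (real_complex R) (map_poly (meval x) (muni p))
    = map_poly (mmap (real_complex R) (fun i => (x i)%:C%C)) (muni p).
Proof.
apply/polyP => k; rewrite !coef_map /= /meval /mmap rmorph_sum.
apply: eq_bigr => m _; rewrite rmorphM /= /mmap1 rmorph_prod; congr (_ * _).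
by apply: eq_bigr => i _; rewrite rmorphXn.
Qed.

(** By homogeneity a zero [(x, z)] gives the zero [(w x, w z)], and [w x] lies in the cone, so
    [stable_root_lt0] applies to [w z]. *)
Lemma stable_neg_roots (n D : nat) (p : {mpoly R[n.+2]}) (x : 'I_n.+1 -> R) :
  p \is D.-homog -> stable p -> (forall i, 0 < x i) ->
  neg_roots (map_poly (meval x) (muni p)).
Proof.
move=> pD p_st x0 z w; rewrite map_meval_complex rootE horner_muni => /eqP pz w0.
have wH : in_cone (fun i => w * (x i)%:C%C).
  split; last first.
    by move=> i; right; case: w w0 => a b /= a0; rewrite mulr0 subr0 mulr_gt0.
  exists ord0; rewrite mulf_neq0 //; first by apply: contraTneq w0 => ->; rewrite ltxx.
  by rewrite eq_complex /= gt_eqF.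
apply: (stable_root_lt0 pD p_st wH); rewrite rootE horner_muni.
by rewrite (mmap_eq _ (fun_rconsZ _ _ _)) (mmap_homogZ _ _ _ pD) pz mulr0.
Qed.

End Stability.

(** * The capacity inequality *)

Section Capacity.
Variable R : realType.
Local Notation C := R[i].
Local Notation Re := (@complex.Re R).

(** In one variable there is a single monomial of each degree. *)
Lemma meval_homog1 (D : nat) (p : {mpoly R[1]}) (k : 'X_{1..1}) :
  p \is D.-homog -> mdeg k = D -> p.@[fun=> 1] = p@_k.
Proof.
move=> /dhomogP pD kD; rewrite mevalE [X in _ = X@_k]mpolyE raddf_sum /=.
rewrite big_seq [RHS]big_seq; apply: eq_bigr => m /pD /= mD.
rewrite mcoeffZ mcoeffX big1 => [|i _]; last by rewrite expr1n.
suff -> : m = k by rewrite eqxx.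
apply/mnmP => i; rewrite ord1; move: mD kD.
by rewrite !mdegE !big_ord1 => -> ->.
Qed.

Lemma stable_capacity (n D : nat) (p : {mpoly R[n.+1]}) (k : 'X_{1..n.+1}) (M : R) :
  p \is D.-homog -> stable p -> mdeg k = D -> (forall i, 0 < k i)%N -> 0 < M ->
  (forall x : 'I_n.+1 -> R, (forall i, 0 < x i) ->
     M * \prod_i x i ^+ k i <= p.@[x]) ->
  M * (D`!%:R * \prod_i (k i)%:R ^+ k i)
    <= p@_k * (D%:R ^+ D * \prod_i (k i)`!%:R).
Proof.
elim: n D p k M => [|n IH] D p k M pD p_st kD k0 M0 pM.
  have := pM (fun=> 1) (fun=> ltr01).
  rewrite (meval_homog1 pD kD) big1 => [|i _]; last by rewrite expr1n.
  move: kD; rewrite mulr1 mdegE !big_ord1 => <- Mp.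
  by rewrite [X in M * X]mulrC ler_wpM2r // mulr_ge0 // exprn_ge0.
pose K := k ord_max; pose k' := mnm_belast k.
have KD : (K <= D)%N by rewrite -kD mdeg_belast leq_addl.
have k'D : mdeg k' = (D - K)%N by rewrite -kD (mdeg_belast k) addnK.
(* [A / B] is the constant of [neg_roots_coef_lb] lost in eliminating the last variable. *)
pose A : R := K%:R ^+ K * (D - K)%:R ^+ (D - K)%N * D`!%:R.
pose B : R := K`!%:R * (D - K)`!%:R * D%:R ^+ D.
have pow0 (a : nat) : 0 < a%:R ^+ a :> R.
  by case: a => [|a]; rewrite ?expr0 ?ltr01 // exprn_gt0 // ltr0n.
have fact0 (a : nat) : 0 < a`!%:R :> R by rewrite ltr0n fact_gt0.
have A0 : 0 < A by rewrite !mulr_gt0.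
have B0 : 0 < B by rewrite !mulr_gt0.
have q_lb x : (forall i, 0 < x i) ->
    M * A / B * \prod_i x i ^+ k' i <= ((muni p)`_K).@[x].
  move=> x0; pose f := map_poly (meval x) (muni p).
  have sf : size f = D.+1.
    rewrite -(size_muni_stable pD p_st (fun i => (x i)%:C%C)) -map_meval_complex.
    by rewrite size_map_poly.
  (* With [x] fixed, its monomial is absorbed into the constant of the univariate bound. *)
  pose Mx := M * \prod_i x i ^+ k' i.
  have Mx0 : 0 < Mx by rewrite mulr_gt0 // prodr_gt0 // => i _; rewrite exprn_gt0.
  have := neg_roots_coef_lb sf (stable_neg_roots pD p_st x0) Mx0.
  move=> /(_ K); rewrite k0 KD => /(_ isT).
  rewrite -/A -/B coef_map /= => lb.
  rewrite mulrAC ler_pdivrMr // mulrAC; apply: lb => t t0.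
  have := pM (fun_rcons x t); rewrite /f horner_muni big_ord_recr /=.
  rewrite fun_rcons_max mulrA => le_t.
  apply: le_trans (le_t _); last first.
    by move=> i; rewrite /fun_rcons; case: unliftP => [j _|_] /=.
  rewrite /Mx; under eq_bigr do rewrite mnmE.
  by under [in leRHS]eq_bigr do rewrite fun_rcons_widen.
have k'0 i : (0 < k' i)%N by rewrite mnmE.
have := IH _ _ _ _ (muni_homog K pD) (stable_muni_coef pD p_st KD) k'D k'0 _ q_lb.
rewrite divr_gt0 ?mulr_gt0 // => /(_ isT).
rewrite -mcoeff_muni.
have -> : \prod_i (k i)%:R ^+ k i = \prod_i (k' i)%:R ^+ k' i * K%:R ^+ K :> R.
  by rewrite big_ord_recr /=; congr (_ * _); apply: eq_bigr => i _; rewrite mnmE.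
have -> : \prod_i (k i)`!%:R = \prod_i (k' i)`!%:R * K`!%:R :> R.
  by rewrite big_ord_recr /=; congr (_ * _); apply: eq_bigr => i _; rewrite mnmE.
(* The telescoping: this factor removes all terms in [D - K], which occur both in [A / B] and in the
   induction hypothesis. *)
have P0 : 0 < B / (D - K)%:R ^+ (D - K) / (D - K)`!%:R :> R.
  by rewrite !divr_gt0.
rewrite -(ler_pM2r P0) => H.
have [a0 b0] := (gt_eqF (pow0 (D - K)%N), gt_eqF (fact0 (D - K)%N)).
apply: le_trans (le_trans H _); rewrite le_eqVlt; apply/orP; left; apply/eqP.
  have := gt_eqF B0; rewrite /A; move: B a0 b0 {P0 H B0 A0 q_lb} => B.
  move: ((D - K)%:R ^+ _) ((D - K)`!%:R) (K%:R ^+ K) (\prod_i _) => a b c d.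
    by move=> a0 b0 B0; field; rewrite a0 b0 B0.
rewrite /B; move: a0 b0 {P0 H B0 A0 q_lb A B}.
move: ((D - K)%:R ^+ _) ((D - K)`!%:R) (K`!%:R) (\prod_i _) => a b c d.
by move=> a0 b0; field; rewrite a0 b0.
Qed.

Lemma prod_homog1 (n : nat) (I : Type) (s : seq I) (L : I -> {mpoly R[n]}) :
  (forall q, L q \is 1.-homog) -> \prod_(q <- s) L q \is (size s).-homog.
Proof.
move=> L1; elim: s => [|q s IH]; first by rewrite big_nil dhomog1.
by rewrite big_cons /= -add1n dhomogM.
Qed.

Definition linform (n : nat) (a : 'I_n -> R) : {mpoly R[n]} :=
  \sum_v a v *: 'X_v.

Lemma linform_homog (n : nat) (a : 'I_n -> R) : linform a \is 1.-homog.
Proof.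
by apply: rpred_sum => v _; apply: dhomogZ; rewrite dhomogX /= mdeg1.
Qed.

Lemma mmap_linform (n : nat) (S : comNzRingType) (f : {rmorphism R -> S})
    (h : 'I_n -> S) (a : 'I_n -> R) :
  mmap f h (linform a) = \sum_v f (a v) * h v.
Proof.
rewrite rmorph_sum; apply: eq_bigr => v _ /=.
by rewrite mmapZ mmapX mmap1U.
Qed.

(** On the cone every term has nonnegative real part, and a nonzero coordinate contributes a
    positive one. *)
Lemma linform_stable (n : nat) (a : 'I_n -> R) :
  (forall v, 0 < a v) -> stable (linform a).
Proof.
move=> a0 z [[i zi] zH]; rewrite mmap_linform.
have ReE v : Re ((a v)%:C%C * z v) = a v * Re (z v).
  by case: (z v) => x y /=; rewrite mul0r subr0.
suff : 0 < Re (\sum_v (a v)%:C%C * z v).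
  by apply: contraTneq => ->; rewrite ltxx.
rewrite Re_sum (bigD1 i) //= ltr_wpDr ?ReE //.
  apply: sumr_ge0 => v _; rewrite ReE; apply: mulr_ge0; first exact: ltW.
  by case: (zH v) => [->|/ltW//]; rewrite lexx.
by rewrite mulr_gt0 //; case: (zH i) zi => [->|//]; rewrite eqxx.
Qed.

(** Continuity at 0, used to let the perturbation of the forms vanish. *)
Lemma poly_lb_at0 (Q : {poly R}) (b : R) :
  (forall e, 0 < e -> b <= Q.[e]) -> b <= Q.[0].
Proof.
move=> Qb; rewrite leNgt; apply/negP => Qlt.
have e0 : 0 < b - Q.[0] by rewrite subr_gt0.
have [d d0 /(_ (d / 2))] := polyrcf.poly_cont 0 Q e0.
rewrite subr0 gtr0_norm ?divr_gt0 // ltr_pdivrMr // ltr_pMr // ltr1n => /(_ isT).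
move=> /(le_lt_trans (ler_norm _)); rewrite ltrD2r ltNge => /negP; apply.
by apply: Qb; rewrite divr_gt0.
Qed.

(* The forms are perturbed by a multiple of the sum of all variables, which
   makes their coefficients positive; the coefficient of the product is a
   polynomial in the perturbation parameter. *)
Lemma prod_linform_capacity (n : nat) (I : finType) (a : I -> 'I_n -> R)
    (k : 'X_{1..n}) (M : R) :
  (0 < n)%N -> (forall q v, 0 <= a q v) ->
  mdeg k = #|I| -> (forall v, 0 < k v)%N -> 0 < M ->
  (forall x : 'I_n -> R, (forall v, 0 < x v) ->
     M * \prod_v x v ^+ k v <= \prod_q \sum_v a q v * x v) ->
  M * ((#|I|)`!%:R * \prod_v (k v)%:R ^+ k v)
    <= (\prod_q linform (a q))@_k * (#|I|%:R ^+ #|I| * \prod_v (k v)`!%:R).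
Proof.
case: n a k => [//|n] a k _ a0 kI k0 M0 aM.
pose b q (e : R) v := a q v + e.
pose B := linform (fun=> 1 : R) : {mpoly R[n.+1]}.
pose H := \prod_q ((linform (a q))%:P + B *: 'X).
pose Q := \poly_(i < size H) (H`_i)@_k.
have QE e : Q.[e] = (\prod_q linform (b q e))@_k.
  have -> : \prod_q linform (b q e) = H.[e%:MP].
    rewrite horner_prod; apply: eq_bigr => q _.
    rewrite !hornerE mulrC mul_mpolyC /linform scaler_sumr -big_split /=.
    by apply: eq_bigr => v _; rewrite scale1r scalerDl.
  rewrite horner_poly (horner_coef H) raddf_sum; apply: eq_bigr => i _ /=.
  by rewrite -rmorphXn /= [in RHS]mulrC mul_mpolyC mcoeffZ mulrC.
have -> : (\prod_q linform (a q))@_k = Q.[0].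
  rewrite QE; congr (_@_k); apply: eq_bigr => q _.
  by apply: eq_bigr => v _; rewrite /b addr0.
have Z0 : 0 < #|I|%:R ^+ #|I| * \prod_v (k v)`!%:R :> R.
  rewrite mulr_gt0 //; last by rewrite prodr_gt0 // => v _; rewrite ltr0n fact_gt0.
  by case: #|I| => [|N]; rewrite ?expr0 ?ltr01 // exprn_gt0 // ltr0n.
rewrite -ler_pdivrMr //; apply: poly_lb_at0 => e e0.
rewrite ler_pdivrMr // QE.
have b0 q v : 0 < b q e v by rewrite ltr_wpDl.
apply: stable_capacity => //.
- rewrite cardE -(big_enum _ _ xpredT) /=.
  by apply: prod_homog1 => q; apply: linform_homog.
- move=> z zH; rewrite rmorph_prod; apply/prodf_neq0 => q _ /=.
  exact: linform_stable.
(* On the positive orthant the perturbation only increases each form, so the lower bound [M]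
   survives. *)
move=> x x0; apply: le_trans (aM x x0) _.
rewrite rmorph_prod; apply: ler_prod => q _; rewrite /= /meval mmap_linform.
apply/andP; split.
  by apply: sumr_ge0 => v _; rewrite mulr_ge0 // ltW.
by apply: ler_sum => v _; rewrite ler_wpM2r ?ltW // ltrDl.
Qed.

End Capacity.

(** * The weighted count as a coefficient *)

Section CountAsCoefficient.
Variables (R : realType) (m n : nat) (r : 'I_m -> nat) (c : 'I_n -> nat).
Variable W : 'M[R]_(m, n).
Local Notation pairs := ('I_m * 'I_n)%type.

Definition split_fun (T : Type) (f : 'I_m -> T) (g : 'I_n -> T) (v : 'I_(m + n)) : T :=
  match split v with inl i => f i | inr j => g j end.

Lemma split_fun_l (T : Type) (f : 'I_m -> T) g i : split_fun f g (lshift n i) = f i.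
Proof. by rewrite /split_fun (unsplitK (inl _ i)). Qed.

Lemma split_fun_r (T : Type) (f : 'I_m -> T) g j : split_fun f g (rshift m j) = g j.
Proof. by rewrite /split_fun (unsplitK (inr _ j)). Qed.

Lemma big_split_fun (T S : Type) (idx : S) (op : Monoid.com_law idx)
    (f : 'I_m -> T) (g : 'I_n -> T) (F : 'I_(m + n) -> T -> S) :
  \big[op/idx]_v F v (split_fun f g v)
    = op (\big[op/idx]_i F (lshift n i) (f i)) (\big[op/idx]_j F (rshift m j) (g j)).
Proof.
rewrite big_split_ord; congr (op _ _); apply: eq_bigr => i _.
  by rewrite split_fun_l.
by rewrite split_fun_r.
Qed.

Lemma big_pairs (S : Type) (idx : S) (op : Monoid.com_law idx) (F : pairs -> S) :
  \big[op/idx]_q F q = \big[op/idx]_i \big[op/idx]_j F (i, j).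
Proof. by rewrite pair_bigA; apply: eq_bigr => -[]. Qed.

(* Coefficients of the form s_i + w_ij y_j, where s_i stands for 1 / x_i. *)
Definition pair_form (q : pairs) : 'I_(m + n) -> R :=
  split_fun (fun i => (i == q.1)%:R) (fun j => W q.1 q.2 * (j == q.2)%:R).

Definition margin : 'X_{1..m + n} :=
  [multinom split_fun (fun i => (n - r i)%N) c v | v < m + n].

Definition set_mnm (J : {set pairs}) : 'X_{1..m + n} :=
  (\sum_q (if q \in J then U_(rshift m q.2) else U_(lshift n q.1)))%MM.

Lemma linform_pair q :
  linform (pair_form q) = 'X_(lshift n q.1) + W q.1 q.2 *: 'X_(rshift m q.2).
Proof.
rewrite /linform (big_split_fun _ _ _ (fun v a => a *: 'X_v)) /=; congr (_ + _).
  rewrite (bigD1 q.1) //= eqxx scale1r big1 ?addr0 // => i /negPf ->.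
  by rewrite scale0r.
rewrite (bigD1 q.2) //= eqxx mulr1 big1 ?addr0 // => i /negPf ->.
by rewrite mulr0 scale0r.
Qed.

Lemma prod_linform_pairE :
  \prod_q linform (pair_form q)
    = \sum_(J in {set pairs}) (\prod_(q in J) W q.1 q.2) *: 'X_[set_mnm J].
Proof.
under eq_bigr do rewrite linform_pair addrC.
rewrite bigA_distr; apply: eq_bigr => J _.
rewrite /set_mnm -mprodXE [X in X *: _]big_mkcond -scaler_prod.
by apply: eq_bigr => q _; case: ifP; rewrite ?scale1r.
Qed.

Lemma set_mnm_l J i :
  set_mnm J (lshift n i) = (n - \sum_(j < n) ((i, j) \in J))%N.
Proof.
rewrite /set_mnm mnm_sumE big_pairs (bigD1 i) //= [X in (_ + X)%N]big1 ?addn0 => [|i' i'i]; last first.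
  rewrite big1 // => j _; case: ifP => _; rewrite mnm1E.
    by rewrite eq_rlshift.
  by rewrite eq_lshift (negPf i'i).
have eqn : (\sum_(j < n) ((i, j) \in J) + \sum_(j < n) ((i, j) \notin J))%N = n.
  rewrite -big_split /= -[RHS]card_ord -sum1_card; apply: eq_bigr => j _.
  by case: (_ \in _).
rewrite -[X in (X - _)%N]eqn addKn; apply: eq_bigr => j _.
by case: ifP => _; rewrite mnm1E ?eq_rlshift // eqxx.
Qed.

Lemma set_mnm_r J j : set_mnm J (rshift m j) = (\sum_(i < m) ((i, j) \in J))%N.
Proof.
rewrite /set_mnm mnm_sumE big_pairs; apply: eq_bigr => i _; rewrite (bigD1 j) //= [X in (_ + X)%N]big1 ?addn0.
  by case: ifP => _; rewrite mnm1E ?eqxx // eq_lrshift.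
move=> j' j'j; case: ifP => _; rewrite mnm1E.
  by rewrite eq_rshift (negPf j'j).
by rewrite eq_lrshift.
Qed.

(** The exponent of [s_i] counts the zeros of row [i]. It determines the row sum because neither
    [r i] nor that sum exceeds [n], so the truncated subtraction can be undone. *)
Lemma set_mnm_margin J : (forall i, r i < n)%N ->
  (set_mnm J == margin) = (\matrix_(i, j) ((i, j) \in J) \in zero_one_mx r c).
Proof.
move=> rn; rewrite inE.
under eq_forallb do under eq_bigr do rewrite mxE.
under [X in _ = _ && X]eq_forallb do under eq_bigr do rewrite mxE.
apply/eqP/andP => [/mnmP JE|[/forallP Jr /forallP Jc]].
  split; apply/forallP.
    move=> i; have := JE (lshift n i); rewrite set_mnm_l mnmE split_fun_l.
    move=> /(congr1 (subn n)); rewrite !subKn ?(ltnW (rn _)) // => [->//|].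
    by rewrite -[X in (_ <= X)%N]card_ord -sum1_card leq_sum // => j _; apply: leq_b1.
  by move=> j; have := JE (rshift m j); rewrite set_mnm_r mnmE split_fun_r => ->.
apply/mnmP => v; rewrite mnmE -[v]splitK; case: (split v) => [i|j] /=.
  by rewrite set_mnm_l split_fun_l (eqP (Jr i)).
by rewrite set_mnm_r split_fun_r (eqP (Jc j)).
Qed.

Lemma mcoeff_prod_pair : (forall i, r i < n)%N ->
  (\prod_q linform (pair_form q))@_margin = weighted_count r c W.
Proof.
move=> rn; rewrite prod_linform_pairE raddf_sum /= /weighted_count.
pose h (J : {set pairs}) : 'M[bool]_(m, n) := \matrix_(i, j) ((i, j) \in J).
pose g (D : 'M[bool]_(m, n)) : {set pairs} := finset (fun q => D q.1 q.2).
have hg : cancel h g by move=> J; apply/setP => -[i j]; rewrite inE mxE.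
have gh : cancel g h by move=> D; apply/matrixP => i j; rewrite mxE inE.
rewrite [RHS](reindex h) /=; last by exists g => x _; [apply: hg | apply: gh].
rewrite [RHS]big_mkcond; apply: eq_bigr => J _.
rewrite mcoeffZ mcoeffX set_mnm_margin //; case: ifP => _; rewrite ?mulr0 // mulr1.
by apply: eq_bigl => -[i j]; rewrite mxE.
Qed.

Hypothesis W_ge0 : forall i j, 0 <= W i j.

(** All terms of the expansion are nonnegative at [x], so those with another monomial may be
    dropped. *)
Lemma mcoeff_prod_pair_le (x : 'I_(m + n) -> R) (k : 'X_{1..m + n}) :
  (forall v, 0 < x v) ->
  (\prod_q linform (pair_form q))@_k * \prod_v x v ^+ k v
    <= (\prod_q linform (pair_form q)).@[x].
Proof.
move=> x0; rewrite prod_linform_pairE !raddf_sum /= mulr_suml.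
apply: ler_sum => J _; rewrite mcoeffZ mcoeffX mevalZ mevalX -mulrA.
apply: ler_wpM2l; first by apply: prodr_ge0 => q _.
case: eqP => [->|_]; first by rewrite mul1r.
by rewrite mul0r prodr_ge0 // => v _; rewrite exprn_ge0 // ltW.
Qed.

(** Each factor [1 + w_ij x_i y_j] is [x_i] times [1 / x_i + w_ij y_j]; row [i] thus needs [n]
    powers of [1 / x_i], of which [Ffun] supplies [r i] and the monomial the rest. *)
Lemma meval_prod_pair x y : (forall i, r i < n)%N ->
  (forall i, 0 < x i) -> (forall j, 0 < y j) ->
  (\prod_q linform (pair_form q)).@[split_fun (fun i => (x i)^-1) y]
    = Ffun r c W x y
      * \prod_v split_fun (fun i => (x i)^-1) y v ^+ margin v.
Proof.
move=> rn x0 y0.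
under [X in _ * X]eq_bigr do rewrite mnmE.
rewrite big_split_ord /=.
under [X in _ * (X * _)]eq_bigr do rewrite !split_fun_l.
under [X in _ * (_ * X)]eq_bigr do rewrite !split_fun_r.
rewrite /Ffun rmorph_prod.
have -> a b s t u : a * b * s * (t * u) = (b * u) * (a * t * s) :> R by ring.
rewrite -!big_split /= [X in X * _]big1 => [|j _]; last first.
  by rewrite mulVf // expf_neq0 // gt_eqF.
rewrite mul1r big_pairs /=.
apply: eq_bigr => i _.
have -> : x i ^- r i * (x i)^-1 ^+ (n - r i) = \prod_(j < n) (x i)^-1.
  by rewrite prodr_const card_ord -exprVn -exprD subnKC // ltnW.
rewrite -big_split /=; apply: eq_bigr => j _.
rewrite linform_pair mevalD mevalZ !mevalXU split_fun_l split_fun_r /=.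
by field; rewrite gt_eqF.
Qed.

End CountAsCoefficient.

(** * Bounds on the weighted count in terms of [alpha] *)

Theorem theorem2p1 (R : realType) (m n N : nat)
    (r : 'I_m -> nat) (c : 'I_n -> nat) (W : 'M[R]_(m, n))
    (sum_r : (\sum_(i < m) r i)%N = N)
    (sum_c : (\sum_(j < n) c j)%N = N)
    (r_bounds : forall i, (0 < r i < n)%N)
    (c_bounds : forall j, (0 < c j < m)%N)
    (W_ge0 : forall i j, 0 <= W i j) :
  alpha r c W >= weighted_count r c W /\
  weighted_count r c W >=
    ((m * n)`!%:R / (m * n)%:R ^+ (m * n))
    * (\prod_(i < m) ((n - r i)%:R ^+ (n - r i) / (n - r i)`!%:R))
    * (\prod_(j < n) ((c j)%:R ^+ c j / (c j)`!%:R))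
    * alpha r c W.
Proof.
have rn i : (r i < n)%N by case/andP: (r_bounds i).
have F_ge (x : 'I_m -> R) (y : 'I_n -> R) : (forall i, 0 < x i) -> (forall j, 0 < y j) ->
    weighted_count r c W <= Ffun r c W x y.
  move=> x0 y0; pose X := split_fun (fun i => (x i)^-1) y.
  have X0 v : 0 < X v by rewrite /X /split_fun; case: split => i; rewrite ?invr_gt0.
  have XX0 : 0 < \prod_v X v ^+ margin r c v.
    by apply: prodr_gt0 => v _; rewrite exprn_gt0.
  rewrite -(ler_pM2r XX0) -(@meval_prod_pair R m n r c W x y rn x0 y0) -(mcoeff_prod_pair c W rn).
  exact: mcoeff_prod_pair_le.
have alpha_ge : weighted_count r c W <= alpha r c W.
  apply: lb_le_inf; last by move=> _ [x [y [x0 y0 ->]]]; apply: F_ge.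
  by exists (Ffun r c W (fun=> 1) (fun=> 1)), (fun=> 1), (fun=> 1).
split=> //.
have wc_ge0 : 0 <= weighted_count r c W.
  by apply: sumr_ge0 => D _; apply: prodr_ge0.
(* The capacity inequality asks for a positive constant; at 0 the claim is the nonnegativity of the
   count. *)
have [a0|a_neq0] := eqVneq (alpha r c W) 0; first by rewrite a0 mulr0.
have a0 : 0 < alpha r c W by rewrite lt_def a_neq0 (le_trans wc_ge0).
have alpha_le (x : 'I_m -> R) (y : 'I_n -> R) : (forall i, 0 < x i) -> (forall j, 0 < y j) ->
    alpha r c W <= Ffun r c W x y.
  move=> x0 y0; apply: ge_inf; last by exists x, y.
  by exists (weighted_count r c W) => _ [x' [y' [x'0 y'0 ->]]]; apply: F_ge.
(* Without variables the capacity inequality does not apply, but the count, [Ffun] and the numerical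
   constant are then all 1, with [0 ^+ 0 = 1]. *)
have [mn0|mn0] := posnP (m + n).
  have no_m (i : 'I_m) : False by case: i; move: mn0; lia.
  have no_n (j : 'I_n) : False by case: j; move: mn0; lia.
  have -> : (m * n = 0)%N by move: mn0; lia.
  rewrite expr0 divr1 big1 => [|i _]; last by case: (no_m i).
  rewrite big1 => [|j _]; last by case: (no_n j).
  rewrite !mul1r -(mcoeff_prod_pair c W rn) big1 => [|[i j] _]; last by case: (no_m i).
  rewrite mcoeff1 (_ : margin r c == 0%MM); last first.
    by apply/eqP/mnmP => v; rewrite /margin; case: v; move: mn0; lia.
  apply: le_trans (alpha_le (fun=> 1) (fun=> 1) _ _) _ => //.
  rewrite /Ffun big1 => [|i _]; last by case: (no_m i).
  rewrite big1 => [|j _]; last by case: (no_n j).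
  by rewrite big1 ?mulr1 // => i; case: (no_m i).
have a_ge0 q v : 0 <= pair_form W q v.
  by rewrite /pair_form /split_fun; case: split => [i|j]; rewrite ?mulr_ge0.
(* The degree is [(mn - N) + N], by the equality of the two total sums. *)
have margin_mn : mdeg (margin r c) = #|{: 'I_m * 'I_n}|.
  rewrite mdegE card_prod !card_ord big_split_ord /=.
  under eq_bigr do rewrite mnmE split_fun_l.
  under [X in (_ + X)%N]eq_bigr do rewrite mnmE split_fun_r.
  rewrite sum_c -sum_r -big_split /= -[X in (X * _)%N]card_ord -sum_nat_const.
  by apply: eq_bigr => i _; rewrite subnK // ltnW.
have margin_gt0 v : (0 < margin r c v)%N.
  rewrite mnmE /split_fun; case: split => [i|j]; first by rewrite subn_gt0.
  by case/andP: (c_bounds j).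
have cap_lb (X : 'I_(m + n) -> R) : (forall v, 0 < X v) ->
    alpha r c W * \prod_v X v ^+ margin r c v
      <= \prod_q \sum_v pair_form W q v * X v.
  (* Every positive point has the form [(1 / x, y)], so [alpha <= Ffun] yields a bound on the whole
     orthant. *)
  move=> X0; pose x i := (X (lshift n i))^-1; pose y j := X (rshift m j).
  have XE : X = split_fun (fun i => (x i)^-1) y.
    apply/funext => v; rewrite -[v]splitK; case: (split v) => i /=.
      by rewrite split_fun_l /x invrK.
    by rewrite split_fun_r.
  have x0 i : 0 < x i by rewrite invr_gt0.
  have y0 j : 0 < y j by apply: X0.
  have -> : \prod_q \sum_v pair_form W q v * X v
      = (\prod_q linform (pair_form W q)).@[X].
    rewrite rmorph_prod; apply: eq_bigr => q _.
    by rewrite /= /meval mmap_linform.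
  rewrite XE (@meval_prod_pair R m n r c W x y rn x0 y0) -XE ler_wpM2r ?alpha_le //.
  by apply: prodr_ge0 => v _; rewrite exprn_ge0 // ltW.
have := prod_linform_capacity mn0 a_ge0 margin_mn margin_gt0 a0 cap_lb.
rewrite mcoeff_prod_pair // card_prod !card_ord !big_split_ord /=.
under eq_bigr do rewrite mnmE split_fun_l.
under [X in _ * (_ * (_ * X)) <= _]eq_bigr do rewrite mnmE split_fun_r.
under [X in _ <= _ * (_ * (X * _))]eq_bigr do rewrite mnmE split_fun_l.
under [X in _ <= _ * (_ * (_ * X))]eq_bigr do rewrite mnmE split_fun_r.
have prod_fact_gt0 (I : finType) (k : I -> nat) : 0 < \prod_i (k i)`!%:R :> R.
  by apply: prodr_gt0 => i _; rewrite ltr0n fact_gt0.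
have pow_gt0 : 0 < (m * n)%:R ^+ (m * n) :> R.
  by case: (m * n)%N => [|k]; rewrite ?expr0 ?ltr01 // exprn_gt0 // ltr0n.
rewrite !prodf_div -ler_pdivrMr ?mulr_gt0 // => /(le_trans _); apply.
rewrite le_eqVlt; apply/orP; left; apply/eqP.
move: (gt_eqF pow_gt0) (gt_eqF (prod_fact_gt0 _ c)) (gt_eqF (prod_fact_gt0 _ (fun i => n - r i)%N)).
move: (_ ^+ (m * n)) (\prod_i (c i)`!%:R) (\prod_i (n - r i)`!%:R) => u v w u0 v0 w0.
by field; rewrite u0 v0 w0.
Qed.
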